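(* Let $\rho$ be an arbitrary two-qubit density matrix, i.e. a density matrix on $\mathbb{C}^2\otimes\mathbb{C}^2$, written as $$\rho=\frac14\sum_{x_1,x_2=0}^3 T_{x_1x_2}\,\sigma_{x_1}\otimes\sigma_{x_2},\qquad T_{x_1x_2}\in\mathbb{R}.$$ Then the asymmetry of $\rho$ with respect to the collective local unitary transformations $R\otimes R$, $R\in\mathbb{SU}(2)$, is $$\mathcal{A}(R\otimes R,\rho)=\frac12-\frac{1}{8\,\mathrm{Tr}\rho^2}\left(1+\frac13\sum_{i,j=1}^3T_{ii}T_{jj}\right).$$
   Context: A density matrix is a positive semidefinite complex matrix of trace $1$. $\sigma_0=\mathbb{I}_2$ and $\sigma_1,\sigma_2,\sigma_3$ are the standard Pauli matrices. The Frobenius norm is $\|A\|_{\mathrm{F}}=\sqrt{\mathrm{Tr}(A^\dagger A)}$, and $[A,B]=AB-BA$. For a compact group $G$ with unitary representation $g\mapsto U(g)$ on the Hilbert space of $\rho$, the asymmetry measure is $$\mathcal{A}(G,\rho)=\frac{1}{4\|\rho\|_{\mathrm{F}}^2}\int_G\big\|[U(g),\rho]\big\|_{\mathrm{F}}^2\,dg,$$ where $dg$ is the normalized Haar measure (total mass $1$). The notation $\mathcal{A}(R\otimes R,\rho)$ denotes this quantity for $G=\mathbb{SU}(2)$ acting on $\mathbb{C}^2\otimes\mathbb{C}^2$ by the representation $R\mapsto R\otimes R$ (the same $R$ on both qubits), that is, $$\mathcal{A}(R\otimes R,\rho)=\frac{1}{4\|\rho\|_{\mathrm{F}}^2}\int_{\mathbb{SU}(2)}\big\|[R\otimes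 R,\rho]\big\|_{\mathrm{F}}^2\,dR.$$ *)

(* Defs.v *)
From HB Require Import structures.
From mathcomp Require Import all_boot all_order all_algebra.
From mathcomp Require Import spectral complex mxtens.
From mathcomp Require Import all_classical all_reals all_analysis.

Set Implicit Arguments.
Unset Strict Implicit.
Unset Printing Implicit Defensive.

Import Order.TTheory GRing.Theory Num.Theory.
Import numFieldNormedType.Exports.

Local Open Scope classical_set_scope.
Local Open Scope ring_scope.
Local Open Scope sesquilinear_scope.
Local Open Scope complex_scope.

Record SU2 (R : realType) := MkSU2 {
  su2_mx :> 'M[R[i]]_2 ;
  su2_mxP : (su2_mx \is unitarymx) && (\det su2_mx == 1) }.

HB.instance Definition _ (R : realType) := [isSub for @su2_mx R].
HB.instance Definition _ (R : realType) := [Choice of SU2 R by <:].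

Section SU2Group.
Variable R : realType.
Implicit Types U V W : SU2 R.

Fact su2_one_subproof :
  ((1%:M : 'M[R[i]]_2) \is unitarymx) && (\det (1%:M : 'M[R[i]]_2) == 1).
Proof.
by rewrite det1 eqxx andbT; apply/unitarymxP; rewrite trmx1 map_mx1 mulmx1.
Qed.
Definition su2_one : SU2 R := MkSU2 su2_one_subproof.

Fact su2_mul_subproof U V : (U *m V \is unitarymx) && (\det (U *m V) == 1).
Proof.
have /andP[uU /eqP dU] := su2_mxP U; have /andP[uV /eqP dV] := su2_mxP V.
by rewrite mul_unitarymx //= det_mulmx dU dV mulr1.
Qed.
Definition su2_mul U V : SU2 R := MkSU2 (su2_mul_subproof U V).

Fact su2_inv_subproof U : (U ^t* \is unitarymx) && (\det (U ^t*) == 1).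
Proof.
have /andP[uU /eqP dU] := su2_mxP U.
by rewrite trmxC_unitary uU det_map_mx det_tr dU rmorph1 /=.
Qed.
Definition su2_inv U : SU2 R := MkSU2 (su2_inv_subproof U).

Fact su2_mulA : associative su2_mul.
Proof. by move=> U V W; apply: val_inj; rewrite /= mulmxA. Qed.

Fact su2_mul1 : left_id su2_one su2_mul.
Proof. by move=> U; apply: val_inj; rewrite /= mul1mx. Qed.

Fact su2_mulr1 : right_id su2_one su2_mul.
Proof. by move=> U; apply: val_inj; rewrite /= mulmx1. Qed.

Fact su2_mulrV : right_inverse su2_one su2_inv su2_mul.
Proof.
move=> U; apply: val_inj => /=.
by apply/unitarymxP; case/andP: (su2_mxP U).
Qed.

Fact su2_mulV : left_inverse su2_one su2_inv su2_mul.
Proof.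
by move=> U; apply/val_inj/mulmx1C; have /(congr1 val) := su2_mulrV U.
Qed.

HB.instance Definition _ := isGroup.Build (SU2 R)
  su2_mulA su2_mul1 su2_mulr1 su2_mulV su2_mulrV.

HB.instance Definition _ := isPointed.Build (SU2 R) su2_one.

(* The subspace topology of the space of 2 x 2 complex matrices; [R[i]^o] is
   [R[i]] with the topology of its norm. *)
HB.instance Definition _ := Topological.copy (SU2 R)
  (initial_topology (fun U : SU2 R => (su2_mx U : 'M[R[i]^o]_2))).

(* The Borel sigma-algebra. *)
HB.instance Definition _ := Measurable.copy (SU2 R)
  (g_sigma_algebraType (@open (SU2 R))).

End SU2Group.

(* A left-invariant Borel probability measure on the compact group SU(2): there
   is exactly one, the normalized Haar measure. *)
Definition is_haar (R : realType) (mu : probability (SU2 R) R) : Prop :=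
  forall (g : SU2 R) (A : set (SU2 R)), measurable A ->
    mu [set (g * h)%g | h in A] = mu A.

Section Asymmetry.
Variable R : realType.
Local Notation C := R[i].

Definition commutator n (A B : 'M[C]_n) : 'M[C]_n := A *m B - B *m A.

(* [\tr (A^t* *m A)] is a nonnegative real element of [R[i]], so [complex.Re] loses
   nothing. *)
Definition frobenius n (A : 'M[C]_n) : R := Num.sqrt (complex.Re (\tr (A ^t* *m A))).

(* In [R[i]], [0 <= z] says that z is real and nonnegative, so the condition
   also forces A to be Hermitian. *)
Definition psd n (A : 'M[C]_n) : Prop :=
  forall v : 'cV[C]_n, 0 <= (v ^t* *m A *m v) 0 0.

Definition density n (rho : 'M[C]_n) : Prop := psd rho /\ \tr rho = 1.

(* G stands for the compact group, mu for its normalized Haar measure and U for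
   the unitary representation. *)
Definition asymmetry d (G : measurableType d) (mu : probability G R) n
    (U : G -> 'M[C]_n) (rho : 'M[C]_n) : R :=
  (4 * frobenius rho ^+ 2)^-1 *
  \int[mu]_(g in [set: G]) (frobenius (commutator (U g) rho) ^+ 2).

Definition collective (V : SU2 R) : 'M[C]_(2 * 2) := tensmx V V.

Definition mx22 (a b c d : C) : 'M[C]_2 :=
  \matrix_(i, j) if i == 0 then (if j == 0 then a else b)
                 else (if j == 0 then c else d).

Definition pauli (k : 'I_4) : 'M[C]_2 :=
  match val k with
  | 0%N => 1%:M
  | 1%N => mx22 0 1 1 0
  | 2%N => mx22 0 (0 -i* 1) (0 +i* 1) 0
  | _   => mx22 1 0 0 (- 1)
  end.

End Asymmetry.

Arguments pauli {R} k.
Arguments collective {R} V.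

(* Main.v *)
Require Import Defs.
From mathcomp Require Import all_boot all_order all_algebra.
From mathcomp Require Import spectral complex mxtens.
From mathcomp Require Import all_classical all_reals all_analysis.
From mathcomp Require Import measurable_realfun ring lra.

Set Implicit Arguments.
Unset Strict Implicit.
Unset Printing Implicit Defensive.

Import Order.TTheory GRing.Theory Num.Theory.
Import numFieldNormedType.Exports.
Local Open Scope classical_set_scope.
Local Open Scope ring_scope.
Local Open Scope sesquilinear_scope.
Local Open Scope complex_scope.

(* For a unitary U and a Hermitian rho, ||[U, rho]||_F^2 is
   2 Tr rho^2 - 2 Tr (rho U rho U^-1).  With U = V (x) V and V s_i V^-1 =
   \sum_k r_ki s_k, the last trace is
   4^-1 \sum_(a, b, i, j) T_ab T_ij r_ai r_bj, so only the second moments of the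
   rotation r of V under the Haar measure matter.  Left translation by i s_m
   changes the sign of r_ai r_bj for a suitable m when a <> b, hence the moment
   vanishes; left translation by the rotation that permutes the axes cyclically
   shows that the moment of r_ai r_aj does not depend on a != 0, so by
   orthogonality of r it is 1/3 if i = j != 0 and 0 otherwise. *)

(** * Bounded Borel functions on SU(2) and invariance of the Haar integral *)

Lemma mx_coord_continuous (T : topologicalType) m n i j :
  continuous (fun M : 'M[T]_(m, n) => M i j).
Proof.
(* The witness constrains only the entry [(i, j)]; every other entry ranges over the whole space. *)
move=> M A nA; exists (fun k l => [set x | k = i -> l = j -> A x]) => [k l|N /=].
  have [->|ki] := eqVneq k i; last first.
    by apply: filterE => x /eqP; rewrite (negbTE ki).
  have [->|lj] := eqVneq l j; last first.
    by apply: filterE => x _ /eqP; rewrite (negbTE lj).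
  by apply: filterS nA => x ? _ _.
by move=> /(_ i j); apply.
Qed.

Lemma mx_continuous (S T : topologicalType) m n (f : S -> 'M[T]_(m, n)) :
  (forall i j, continuous (fun x => f x i j)) -> continuous f.
Proof.
move=> fc x A [P nP sPA].
suff : nbhs x [set y | forall i j, P i j (f y i j)].
  by apply: filterS => y /sPA.
apply: filter_forall => i; apply: filter_forall => j.
exact: fc (nP i j).
Qed.

Section SU2Measure.
Context {R : realType}.

(** Multiplication by i preserves the modulus and turns the imaginary part, up to sign, into a real
    part. *)
Lemma normc_ge_Im (x : R[i]) : `|complex.Im x|%:C <= `|x|.
Proof.
rewrite -normrN -ReiNIm (le_trans (normc_ge_Re _))//.
by rewrite normrM complexiE normCi mulr1.
Qed.

Lemma Re_continuous : continuous (@complex.Re R : R[i]^o -> R).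
Proof.
move=> z A /nbhs_ballP[e /= e0 eA]; apply/nbhs_ballP.
exists e%:C; first by rewrite /= ltcR.
move=> w zw; apply: eA; rewrite /ball /= in zw *.
rewrite -ltcR; apply: le_lt_trans zw.
by rewrite -(raddfB (@complex.Re R : Rcomplex R -> R)) normc_ge_Re.
Qed.

Lemma Im_continuous : continuous (@complex.Im R : R[i]^o -> R).
Proof.
move=> z A /nbhs_ballP[e /= e0 eA]; apply/nbhs_ballP.
exists e%:C; first by rewrite /= ltcR.
move=> w zw; apply: eA; rewrite /ball /= in zw *.
rewrite -ltcR; apply: le_lt_trans zw.
by rewrite -(raddfB (@complex.Im R : Rcomplex R -> R)) normc_ge_Im.
Qed.

Lemma su2_mx_continuous :
  continuous (fun V : SU2 R => (su2_mx V : 'M[R[i]^o]_2)).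
Proof. exact: initial_continuous. Qed.

(** The topology of [SU2 R] is initial for the inclusion into matrices, so it suffices that N |-> gN
    is continuous on all matrices; its entries are linear forms in those of N. *)
Lemma su2_mull_continuous (g : SU2 R) : continuous (fun h : SU2 R => (g * h)%g).
Proof.
apply/continuousP => _ [B oB <-].
rewrite -comp_preimage.
move: B oB; apply/continuousP.
pose m (N : 'M[R[i]^o]_2) : 'M[R[i]^o]_2 := su2_mx g *m N.
suff mc : continuous m.
  rewrite -[X in continuous X]/(m \o (fun V : SU2 R => (su2_mx V : 'M[R[i]^o]_2))).
  by move=> x; apply: continuous_comp; [exact: su2_mx_continuous|exact: mc].
apply: (@mx_continuous 'M[R[i]^o]_2 R[i]^o 2 2 m) => i j.
rewrite (_ : (fun _ => _) = (fun N : 'M[R[i]^o]_2 =>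
    (g i ord0 : R[i]^o) * N ord0 j + (g i ord_max : R[i]^o) * N ord_max j)).
  move=> N.
  have h k : (fun N : 'M[R[i]^o]_2 => (g i k : R[i]^o) * N k j) @ N -->
      (g i k : R[i]^o) * N k j.
    have := @mx_coord_continuous R[i]^o 2 2 k j N.
    by move=> /(@cvgMl_tmp R[i] _ _ _ _ (g i k)); apply.
  exact: cvgD (h _) (h _).
apply/funext => N; rewrite mxE !big_ord_recl big_ord0 addr0.
by rewrite (_ : lift _ _ = ord_max)//; apply: val_inj.
Qed.

Lemma measurable_su2_mull (g : SU2 R) :
  measurable_fun setT (fun h : SU2 R => (g * h)%g).
Proof.
apply: (@measurability _ _ (SU2 R) (SU2 R) _ _ (@open (SU2 R))) => //.
move=> _ [A oA <-]; rewrite setTI; apply: sub_sigma_algebra.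
by move/continuousP: (@su2_mull_continuous g); apply.
Qed.

Lemma continuous_measurable_su2 (f : SU2 R -> R) : continuous f ->
  measurable_fun setT f.
Proof.
move=> /continuousP fc.
apply: (@measurability _ _ (SU2 R) (measurableTypeR R) setT f _
  (RGenOpens.measurableE R)).
move=> _ [_ [a [b ->] <-]]; rewrite setTI; apply: sub_sigma_algebra.
exact/fc/interval_open.
Qed.

(** A class closed under sums and products whose members are integrable for every probability
    measure: integrability of the polynomial integrands below then needs no further estimate. *)
Definition bounded_measurable (f : SU2 R -> R) :=
  measurable_fun setT f /\ exists M, forall V, `|f V| <= M.

Lemma bounded_measurable_cst c : bounded_measurable (fun=> c).
Proof. by split; [exact: measurable_cst | exists `|c|]. Qed.

Lemma bounded_measurableD f g : bounded_measurable f -> bounded_measurable g ->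
  bounded_measurable (fun V => f V + g V).
Proof.
move=> [mf [M fM]] [mg [N gN]]; split; first exact: measurable_funD.
by exists (M + N) => V; rewrite (le_trans (ler_normD _ _))// lerD.
Qed.

Lemma bounded_measurableM f g : bounded_measurable f -> bounded_measurable g ->
  bounded_measurable (fun V => f V * g V).
Proof.
move=> [mf [M fM]] [mg [N gN]]; split; first exact: measurable_funM.
by exists (M * N) => V; rewrite normrM ler_pM.
Qed.

Lemma bounded_measurable_sum (I : Type) (r : seq I) (P : pred I)
    (F : I -> SU2 R -> R) :
  (forall i, P i -> bounded_measurable (F i)) ->
  bounded_measurable (fun V => \sum_(i <- r | P i) F i V).
Proof.
move=> mF.
(* The pointwise sum is recast as an iterated sum of functions, so that [big_ind] applies to the
   functions themselves. *)
rewrite -(_ : \big[(fun f g V => f V + g V)/(fun=> 0)]_(i <- r | P i) F i =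
  (fun V => \sum_(i <- r | P i) F i V)).
  by apply: big_ind => //; [exact: bounded_measurable_cst |exact: bounded_measurableD].
by apply/funext => V; elim/big_ind2: _ => // f a g b <- <-.
Qed.

(** The rows of a unitary matrix have norm 1, and the square of [|V i j|] is one term of the squared
    norm of row i. *)
Lemma su2_entry_le1 (V : SU2 R) i j : `|V i j| <= 1.
Proof.
have /andP[/unitarymxP uV _] := su2_mxP V.
have /matrixP /(_ i i) := uV; rewrite !mxE eqxx (bigD1 j)//= !mxE.
rewrite -normCK => e; rewrite -(@expr_le1 _ 2)// -[leRHS]e lerDl.
by apply: sumr_ge0 => k _; rewrite !mxE mul_conjC_ge0.
Qed.

Lemma bounded_measurable_entry (p : R[i]^o -> R) i j :
  continuous p -> (forall z, `|p z|%:C <= `|z|) ->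
  bounded_measurable (fun V => p (V i j)).
Proof.
move=> cp p_le; split; last first.
  by exists 1 => V; rewrite -lecR (le_trans (p_le _))// su2_entry_le1.
apply: continuous_measurable_su2 => V.
apply: (continuous_comp (f := fun V : SU2 R => (V i j : R[i]^o))); last exact: cp.
apply: (continuous_comp (f := fun V : SU2 R => (su2_mx V : 'M[R[i]^o]_2))
     (g := fun M : 'M[R[i]^o]_2 => M i j)); first exact: su2_mx_continuous.
exact: mx_coord_continuous.
Qed.

Lemma bounded_measurable_Re i j :
  bounded_measurable (fun V => complex.Re (V i j)).
Proof. exact: bounded_measurable_entry Re_continuous (@normc_ge_Re R). Qed.

Lemma bounded_measurable_Im i j :
  bounded_measurable (fun V => complex.Im (V i j)).
Proof. exact: bounded_measurable_entry Im_continuous normc_ge_Im. Qed.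

Variable mu : probability (SU2 R) R.
Local Notation E f := (\int[mu]_(V in [set: SU2 R]) f V).

Lemma bounded_measurable_integrable f : bounded_measurable f ->
  mu.-integrable setT (EFin \o f).
Proof.
move=> [mf [M fM]]; apply: measurable_bounded_integrable => //.
  by rewrite ltey_eq fin_num_measure.
exists M; split; first exact: num_real.
by move=> x Mx V _; apply: le_trans (fM V) _; exact: ltW.
Qed.

Hypothesis mu_haar : is_haar mu.

(** Change of variables: the left side is the integral of f against the pushforward of mu by left
    translation, and this pushforward is mu. *)
Lemma haar_translate g f : bounded_measurable f -> E (fun h => f (g * h)%g) = E f.
Proof.
move=> bf; have [mf [M fM]] := bf; rewrite /Rintegral; congr fine.
have mg := measurable_su2_mull g.
have mEf : measurable_fun setT (EFin \o f) by exact/measurable_EFinP.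
rewrite -(@integral_pushforward _ _ _ _ _ _ mg mu setT (EFin \o f))//; last first.
  apply: (@bounded_measurable_integrable (fun h => f (g * h)%g)).
  by split; [exact: measurableT_comp | exists M].
apply: eq_measure_integral => A mA _ /=.
(* [is_haar] speaks of images, so the preimage of A under translation by g is seen as the image of A
   under translation by [g^-1]. *)
rewrite /pushforward -(mu_haar g^-1%g mA)//; congr (mu _).
rewrite eqEsubset; split => [h /= Agh|_ [h Ah <-] /=]; last by rewrite mulgA mulgV mul1g.
by exists (g * h)%g => //; rewrite mulgA mulVg mul1g.
Qed.
End SU2Measure.

(** * Pauli matrices *)

Section Pauli.
Context {R : realType}.
Local Notation C := R[i].
Implicit Types (A B : 'M[C]_2) (k l : 'I_4).

Lemma mx22E (A : 'M[C]_2) : A = mx22 (A 0 0) (A 0 1) (A 1 0) (A 1 1).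
Proof.
apply/matrixP => i j; rewrite mxE.
by case: i => [[|[|//]] hi]; case: j => [[|[|//]] hj] /=; congr (A _ _); apply: val_inj.
Qed.

Lemma mul_mx22 (a b c d a' b' c' d' : C) : mx22 a b c d *m mx22 a' b' c' d' =
  mx22 (a * a' + b * c') (a * b' + b * d') (c * a' + d * c') (c * b' + d * d').
Proof.
apply/matrixP => i j; rewrite !mxE !big_ord_recl big_ord0 !mxE /= addr0.
by do 2 case: ifP.
Qed.

Lemma adj_mx22 (a b c d : C) : (mx22 a b c d)^t* = mx22 a^* c^* b^* d^*.
Proof. by apply/matrixP => i j; rewrite !mxE; do 2 case: ifP. Qed.

Lemma tr_mx22 (a b c d : C) : \tr (mx22 a b c d) = a + d.
Proof. by rewrite /mxtrace !big_ord_recl big_ord0 !mxE /= addr0. Qed.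

Lemma scale_mx22 (x a b c d : C) :
  x *: mx22 a b c d = mx22 (x * a) (x * b) (x * c) (x * d).
Proof. by apply/matrixP => i j; rewrite !mxE; do 2 case: ifP. Qed.

Lemma mx22_1 : 1%:M = mx22 1 0 0 1 :> 'M[C]_2.
Proof. by rewrite [LHS]mx22E !mxE. Qed.

Lemma det_mx22 (a b c d : C) : \det (mx22 a b c d) = a * d - b * c.
Proof.
rewrite (expand_det_row _ 0) !big_ord_recl big_ord0 addr0 /cofactor !det_mx11 !mxE /=.
by ring.
Qed.

Ltac mx22_simp := rewrite ?(mx22_1, scale_mx22, adj_mx22, mul_mx22, tr_mx22).

Ltac complex_eq :=
  apply/eqP; rewrite eq_complex /=; apply/andP; split; apply/eqP; simpl;
  (ring || lra).

Ltac mx22_eq := mx22_simp; congr mx22; complex_eq.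

Ltac ord4_cases k := case: k => [[|[|[|[|//]]]] ?].

Lemma pauli_adj k : (pauli k)^t* = pauli k :> 'M[C]_2.
Proof. by ord4_cases k; rewrite /pauli /=; mx22_eq. Qed.

Lemma pauli0 : pauli ord0 = 1%:M :> 'M[C]_2. Proof. by []. Qed.

Lemma pauli_tr_mul k l : \tr (pauli k *m pauli l) = (2 * (k == l))%:R :> C.
Proof.
by ord4_cases k; ord4_cases l; rewrite /pauli /=; mx22_simp; complex_eq.
Qed.

Lemma pauli_tr k : \tr (pauli k) = (2 * (k == ord0))%:R :> C.
Proof. by rewrite -pauli_tr_mul pauli0 mulmx1. Qed.

(** Parseval's identity for the bilinear form Tr(AB), in which the Pauli matrices are an orthogonal
    basis with Tr(s_k^2) = 2. No adjoint occurs, so A and B are arbitrary. *)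
Lemma pauli_parseval A B :
  \sum_k \tr (pauli k *m A) * \tr (pauli k *m B) = 2 * \tr (A *m B).
Proof.
rewrite (mx22E A) (mx22E B) !big_ord_recl big_ord0 /pauli /=; mx22_simp.
move: (A 0 0) (A 0 1) (A 1 0) (A 1 1) (B 0 0) (B 0 1) (B 1 0) (B 1 1).
move=> [a a'] [b b'] [c c'] [d d'] [e e'] [f f'] [g g'] [h h'].
complex_eq.
Qed.

(** The sign that s_k acquires under conjugation by s_m, for m nonzero: s_m commutes with s_0 and
    s_m and anticommutes with the other two. *)
Definition pauli_sign (m k : 'I_4) : R :=
  if (k == ord0) || (k == m) then 1 else -1.

(** The Pauli matrices other than the identity have determinant -1; the factor i contributes its
    square and brings the determinant to 1. *)
Lemma ipauli_subproof m : m != ord0 ->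
  ('i%C *: pauli m \is @unitarymx C 2 2) && (\det ('i%C *: pauli m : 'M[C]_2) == 1).
Proof.
move=> m0; apply/andP; split.
  apply/unitarymxP; move: m0; ord4_cases m => // _; rewrite /pauli /=; mx22_eq.
move: m0; ord4_cases m => // _; rewrite /pauli /= scale_mx22 det_mx22;
  apply/eqP; complex_eq.
Qed.

Lemma ipauli_conj m k : m != ord0 ->
  ('i%C *: pauli m)^t* *m pauli k *m ('i%C *: pauli m) =
    (pauli_sign m k)%:C *: pauli k :> 'M[C]_2.
Proof.
by move=> m0; move: m0; ord4_cases m => // _; ord4_cases k;
  rewrite /pauli /pauli_sign /=; mx22_eq.
Qed.

(* The rotation by 2 pi / 3 about the axis (1, 1, 1). *)
Definition rot3 : 'M[C]_2 :=
  mx22 (2^-1 +i* 2^-1) (2^-1 +i* 2^-1) (- 2^-1 +i* 2^-1) (2^-1 -i* 2^-1).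

Lemma rot3_subproof : (rot3 \is unitarymx) && (\det rot3 == 1).
Proof.
apply/andP; split.
  apply/unitarymxP; rewrite /rot3; mx22_eq.
by rewrite /rot3 det_mx22; apply/eqP; complex_eq.
Qed.

(** The map [(k %% 3).+1] is the cycle 1 -> 2 -> 3 -> 1 of the nonzero indices. *)
Lemma rot3_conj k l : k != ord0 -> l = (k %% 3)%N.+1 :> nat ->
  rot3^t* *m pauli k *m rot3 = pauli l.
Proof.
by ord4_cases k => // _; ord4_cases l => // _; rewrite /pauli /rot3 /=; mx22_eq.
Qed.

End Pauli.

(** * The rotation induced by a unitary matrix *)

Lemma mxtrace_tens (K : comPzRingType) m n (A : 'M[K]_m) (B : 'M[K]_n) :
  \tr (tensmx A B) = \tr A * \tr B.
Proof. by rewrite /mxtrace mulr_sum; apply: eq_bigr => i _; rewrite mxE. Qed.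

Section Conj.
Context {K : numClosedFieldType}.

Lemma adjmxM m n p (A : 'M[K]_(m, n)) (B : 'M[K]_(n, p)) :
  (A *m B)^t* = B^t* *m A^t*.
Proof. by rewrite trmx_mul map_mxM. Qed.

Lemma adjmx_tens m n p q (A : 'M[K]_(m, n)) (B : 'M[K]_(p, q)) :
  (tensmx A B)^t* = tensmx (A^t*) (B^t*).
Proof. by rewrite trmx_tens map_mxT. Qed.

Lemma mxtrace_adj n (A : 'M[K]_n) : \tr (A^t*) = Num.conj (\tr A).
Proof. by rewrite /mxtrace rmorph_sum; apply: eq_bigr => i _; rewrite !mxE. Qed.
End Conj.

Section Rotation.
Context {R : realType}.
Local Notation C := R[i].

(** Tr(AB) is its own conjugate: the adjoint of AB is BA, which has the same trace. *)
Lemma mxtrace_herm_real n (A B : 'M[C]_n) : A^t* = A -> B^t* = B ->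
  \tr (A *m B) = (complex.Re (\tr (A *m B)))%:C.
Proof.
move=> hA hB; have : Num.conj (\tr (A *m B)) = \tr (A *m B).
  by rewrite -mxtrace_adj adjmxM hA hB mxtrace_mulC.
by case: (\tr _) => x y [] yy; congr (_ +i* _); lra.
Qed.

(** The coefficient of s_k in V s_i V^-1 for unitary V, where 2 = Tr(s_k^2). The index 0 is
    included, so the spatial rotation is the 3 x 3 block of nonzero indices. *)
Definition rotation (V : 'M[C]_2) (k i : 'I_4) : R :=
  complex.Re (\tr (pauli k *m (V *m pauli i *m V^t*))) / 2.

Lemma conj_pauli_herm (V : 'M[C]_2) i :
  (V *m pauli i *m V^t*)^t* = V *m pauli i *m V^t*.
Proof. by rewrite !adjmxM trmxCK pauli_adj mulmxA. Qed.

Lemma rotationE V k i :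
  \tr (pauli k *m (V *m pauli i *m V^t*)) = (2 * rotation V k i)%:C.
Proof.
rewrite mxtrace_herm_real ?pauli_adj ?conj_pauli_herm //; congr (_%:C).
by rewrite /rotation mulrC divfK.
Qed.

Lemma adj_unitarymxK n (V : 'M[C]_n) : V \is unitarymx -> V^t* *m V = 1%:M.
Proof. by move=> /unitarymxP/mulmx1C. Qed.

(** Conjugation preserves the trace, and s_0 alone has nonzero trace. *)
Lemma rotation0l V i : V \is unitarymx -> rotation V ord0 i = (i == ord0)%:R.
Proof.
move=> uV; have := rotationE V ord0 i.
rewrite pauli0 mul1mx mxtrace_mulC mulmxA adj_unitarymxK// mul1mx pauli_tr.
rewrite natrM -(rmorph_nat (real_complex R)) -(rmorph_nat (real_complex R) (_ == _)).
rewrite -rmorphM => /complexI h; apply: (@mulfI _ 2); first by rewrite pnatr_eq0.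
by rewrite h.
Qed.

(** Parseval applied to the images of s_i and s_j; conjugation by V cancels inside the trace and
    leaves Tr(s_i s_j). *)
Lemma rotation_orthogonal V i j : V \is unitarymx ->
  \sum_k rotation V k i * rotation V k j = (i == j)%:R.
Proof.
move=> uV; have := pauli_parseval (V *m pauli i *m V^t*) (V *m pauli j *m V^t*).
have -> : \tr (V *m pauli i *m V^t* *m (V *m pauli j *m V^t*)) = (2 * (i == j))%:R.
  rewrite -!mulmxA (mulmxA (V^t*)) adj_unitarymxK// mul1mx mxtrace_mulC -!mulmxA.
  by rewrite adj_unitarymxK// mulmx1 pauli_tr_mul.
under eq_bigr do rewrite !rotationE -rmorphM.
rewrite -rmorph_sum -natrM -(rmorph_nat (real_complex R)) => /complexI h.
apply: (@mulfI _ 4); first by rewrite pnatr_eq0.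
rewrite -natrM -[in RHS](mulnA 2 2) -h mulr_sumr; apply: eq_bigr => k _; ring.
Qed.

(** Cyclicity of the trace moves g from V onto s_k, so a left translation acts on the row index
    only. *)
Lemma rotationM (g V : 'M[C]_2) (s : R) k l i :
  g^t* *m pauli k *m g = s%:C *: pauli l ->
  rotation (g *m V) k i = s * rotation V l i.
Proof.
move=> gk; apply: (@mulfI _ 2); first by rewrite pnatr_eq0.
apply: (@complexI R); rewrite -rotationE adjmxM !mulmxA.
rewrite mxtrace_mulC !mulmxA gk -!scalemxAl mxtraceZ.
by rewrite -[_ *m V^t*]mulmxA -mulmxA (mulmxA V) rotationE -rmorphM mulrCA.
Qed.

(** V acts on each tensor factor separately, so the trace of each term is a product (2 r_ai)(2
    r_bj); this 4 cancels one of the two prefactors 1/4. *)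
Lemma trace_twirl (T : 'I_4 -> 'I_4 -> R) (rho : 'M[C]_(2 * 2)) (V : 'M[C]_2) :
  rho = 4^-1 *: \sum_(x1 < 4) \sum_(x2 < 4)
         (T x1 x2)%:C *: tensmx (pauli x1) (pauli x2) ->
  \tr (rho *m (tensmx V V *m rho *m (tensmx V V)^t*)) =
  (4^-1 * \sum_(a < 4) \sum_(b < 4) \sum_(i < 4) \sum_(j < 4)
    T a b * T i j * (rotation V a i * rotation V b j))%:C.
Proof.
move=> rhoE.
have -> : tensmx V V *m rho *m (tensmx V V)^t* =
  4^-1 *: \sum_(i < 4) \sum_(j < 4) (T i j)%:C *:
    tensmx (V *m pauli i *m V^t*) (V *m pauli j *m V^t*).
  rewrite rhoE adjmx_tens -scalemxAr -scalemxAl; congr (_ *: _).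
  rewrite mulmx_sumr mulmx_suml; apply: eq_bigr => i _.
  rewrite mulmx_sumr mulmx_suml; apply: eq_bigr => j _.
  by rewrite -scalemxAr -scalemxAl !tensmx_mul.
rewrite {}rhoE -scalemxAl mxtraceZ mulmx_suml raddf_sum /= rmorphM rmorph_sum.
rewrite !mulr_sumr; apply: eq_bigr => a _.
rewrite mulmx_suml raddf_sum /= rmorph_sum !mulr_sumr; apply: eq_bigr => b _.
rewrite -scalemxAl mxtraceZ -scalemxAr mxtraceZ mulmx_sumr raddf_sum /= rmorph_sum.
rewrite !mulr_sumr; apply: eq_bigr => i _.
rewrite mulmx_sumr raddf_sum /= rmorph_sum !mulr_sumr; apply: eq_bigr => j _.
rewrite -scalemxAr mxtraceZ tensmx_mul mxtrace_tens !rotationE.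
rewrite -!rmorphM.
have -> : 4^-1 = (4^-1 : R)%:C :> C by rewrite fmorphV rmorph_nat.
rewrite -!rmorphM; congr (_%:C); lra.
Qed.
End Rotation.

(** * Second moments of the rotation matrix *)

Section Haar.
Context {R : realType}.
Local Notation C := R[i].

Definition bounded_measurableC (f : SU2 R -> C) :=
  bounded_measurable (fun V => complex.Re (f V)) /\
  bounded_measurable (fun V => complex.Im (f V)).

Lemma bounded_measurableC_cst c : bounded_measurableC (fun=> c).
Proof. by split; exact: bounded_measurable_cst. Qed.

Lemma bounded_measurableCD f g : bounded_measurableC f -> bounded_measurableC g ->
  bounded_measurableC (fun V => f V + g V).
Proof.
move=> [rf jf] [rg jg]; split.
  rewrite (_ : (fun _ => _) = (fun V => complex.Re (f V) + complex.Re (g V))).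
    exact: bounded_measurableD.
  by apply/funext => V; rewrite raddfD.
rewrite (_ : (fun _ => _) = (fun V => complex.Im (f V) + complex.Im (g V))).
  exact: bounded_measurableD.
by apply/funext => V; rewrite raddfD.
Qed.

Lemma bounded_measurableCM f g : bounded_measurableC f -> bounded_measurableC g ->
  bounded_measurableC (fun V => f V * g V).
Proof.
move=> [rf jf] [rg jg]; split.
  rewrite (_ : (fun _ => _) = (fun V => complex.Re (f V) * complex.Re (g V) +
      (-1) * (complex.Im (f V) * complex.Im (g V)))).
    apply: bounded_measurableD; first exact: bounded_measurableM.
    apply: bounded_measurableM; first exact: bounded_measurable_cst.
    exact: bounded_measurableM.
  by apply/funext => V; case: (f V) (g V) => [a b] [c d] /=; rewrite mulN1r.
rewrite (_ : (fun _ => _) = (fun V => complex.Re (f V) * complex.Im (g V) +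
    complex.Im (f V) * complex.Re (g V))).
  by apply: bounded_measurableD; exact: bounded_measurableM.
by apply/funext => V; case: (f V) (g V) => [a b] [c d].
Qed.

Lemma bounded_measurableC_conj f : bounded_measurableC f ->
  bounded_measurableC (fun V => Num.conj (f V)).
Proof.
move=> [rf jf]; split.
  rewrite (_ : (fun _ => _) = (fun V => complex.Re (f V)))//.
  by apply/funext => V; case: (f V).
rewrite (_ : (fun _ => _) = (fun V => -1 * complex.Im (f V))).
  by apply: bounded_measurableM => //; exact: bounded_measurable_cst.
by apply/funext => V; case: (f V) => x y; rewrite mulN1r.
Qed.

Lemma bounded_measurableC_sum n (F : 'I_n -> SU2 R -> C) :
  (forall i, bounded_measurableC (F i)) ->
  bounded_measurableC (fun V => \sum_i F i V).
Proof.
elim: n F => [|n IH] F mF.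
  under eq_fun do rewrite big_ord0; exact: bounded_measurableC_cst.
under eq_fun do rewrite big_ord_recl.
by apply: bounded_measurableCD => //; exact: IH.
Qed.

Definition bounded_measurable_mx m n (A : SU2 R -> 'M[C]_(m, n)) :=
  forall i j, bounded_measurableC (fun V => A V i j).

Lemma bounded_measurable_mulmx m n p (A : SU2 R -> 'M[C]_(m, n))
    (B : SU2 R -> 'M[C]_(n, p)) :
  bounded_measurable_mx A -> bounded_measurable_mx B ->
  bounded_measurable_mx (fun V => A V *m B V).
Proof.
move=> mA mB i j.
rewrite (_ : (fun _ => _) = (fun V => \sum_k A V i k * B V k j)).
  by apply: bounded_measurableC_sum => k; apply: bounded_measurableCM.
by apply/funext => V; rewrite mxE.
Qed.

(** The function is the real part of a polynomial in the entries of V and their conjugates. *)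
Lemma bounded_measurable_rotation k i :
  bounded_measurable (fun V : SU2 R => rotation V k i).
Proof.
rewrite /rotation; apply: bounded_measurableM; last exact: bounded_measurable_cst.
have mC m n (A : 'M[C]_(m, n)) : bounded_measurable_mx (fun=> A).
  by move=> ? ?; exact: bounded_measurableC_cst.
have mV : bounded_measurable_mx (@su2_mx R).
  by move=> a b; split; [exact: bounded_measurable_Re|exact: bounded_measurable_Im].
suff [] : bounded_measurableC
  (fun V => \tr (pauli k *m (su2_mx V *m pauli i *m V^t*))) by [].
apply: bounded_measurableC_sum => a.
apply: bounded_measurable_mulmx => //; apply: bounded_measurable_mulmx.
  exact: bounded_measurable_mulmx.
move=> c d; rewrite (_ : (fun _ => _) = (fun V : SU2 R => Num.conj (V d c))).
  exact: bounded_measurableC_conj.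
by apply/funext => V; rewrite !mxE.
Qed.

Variable mu : probability (SU2 R) R.
Local Notation E f := (\int[mu]_(V in [set: SU2 R]) f V).

Lemma haar_cst c : E (fun=> c) = c.
Proof.
by rewrite Rintegral_cst// [X in fine X](_ : _ = 1%E) ?mulr1//; exact: probability_setT.
Qed.

Lemma haarD f g : bounded_measurable f -> bounded_measurable g ->
  E (fun V => f V + g V) = E f + E g.
Proof.
by move=> mf mg; rewrite RintegralD//; exact: bounded_measurable_integrable.
Qed.

Lemma haarZ c f : bounded_measurable f -> E (fun V => c * f V) = c * E f.
Proof.
by move=> mf; rewrite RintegralZl//; exact: bounded_measurable_integrable.
Qed.

Lemma haar_sum n (F : 'I_n -> SU2 R -> R) :
  (forall i, bounded_measurable (F i)) ->
  E (fun V => \sum_i F i V) = \sum_i E (F i).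
Proof.
elim: n F => [|n IH] F mF.
  by rewrite big_ord0; under eq_Rintegral do rewrite big_ord0; rewrite haar_cst.
rewrite big_ord_recl -IH//; under eq_Rintegral do rewrite big_ord_recl.
by rewrite haarD//; apply: bounded_measurable_sum.
Qed.

Hypothesis mu_haar : is_haar mu.

Let bounded_measurable_rotation2 k i l j :
  bounded_measurable (fun V : SU2 R => rotation V k i * rotation V l j).
Proof. by apply: bounded_measurableM; exact: bounded_measurable_rotation. Qed.

Lemma haar_rotation_neq k i l j : k != l ->
  E (fun V => rotation V k i * rotation V l j) = 0.
Proof.
move=> kl.
(* If k or l is 0, m is any nonzero index different from the other one; otherwise m = k works, since
   s_k commutes with itself and anticommutes with s_l. *)
have [m m0 skl] : exists2 m, m != ord0 & pauli_sign m k * pauli_sign m l = -1 :> R.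
  rewrite /pauli_sign; have [k0|k0] := eqVneq k ord0.
    have [m] : exists m : 'I_4, (m != ord0) && (m != l).
      move: l kl; case=> [[|[|[|[|//]]]] hl] _.
      - by exists (@Ordinal 4 1 isT).
      - by exists (@Ordinal 4 2 isT).
      - by exists (@Ordinal 4 1 isT).
      - by exists (@Ordinal 4 1 isT).
    move=> /andP[m0 ml]; exists m => //.
    by rewrite -k0 [l == k]eq_sym (negbTE kl) [l == m]eq_sym (negbTE ml) mul1r.
  have [l0|l0] := eqVneq l ord0.
    have [m] : exists m : 'I_4, (m != ord0) && (m != k).
      move: k {kl} k0; case=> [[|[|[|[|//]]]] hl] _ //.
      - by exists (@Ordinal 4 2 isT).
      - by exists (@Ordinal 4 1 isT).
      - by exists (@Ordinal 4 1 isT).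
    move=> /andP[m0 mk]; exists m => //.
    by rewrite [k == m]eq_sym (negbTE mk) mulr1.
  by exists k => //; rewrite eqxx orbT /= [l == k]eq_sym (negbTE kl) mul1r.
pose g : SU2 R := MkSU2 (ipauli_subproof m0).
set f := fun V : SU2 R => _.
have mf : bounded_measurable f by exact: bounded_measurable_rotation2.
(* Translation by i s_m multiplies the integrand by the product of the two signs, which is -1. *)
have : E f = - E f.
  rewrite -[LHS](haar_translate mu_haar g) // -mulN1r -haarZ //.
  apply: eq_Rintegral => V _; rewrite /f.
  rewrite (rotationM _ _ (ipauli_conj k m0)) (rotationM _ _ (ipauli_conj l m0)).
  by rewrite mulrACA skl.
lra.
Qed.

Lemma haar_rotation0 i j :
  E (fun V => rotation V ord0 i * rotation V ord0 j) = ((i == ord0) && (j == ord0))%:R.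
Proof.
rewrite -[RHS]haar_cst; apply: eq_Rintegral => V _.
have /andP[uV _] := su2_mxP V.
by rewrite !rotation0l// -natrM mulnb.
Qed.

Lemma haar_rotation_eq k i j : k != ord0 ->
  E (fun V => rotation V k i * rotation V k j) = ((i == j) && (i != ord0))%:R / 3.
Proof.
pose e k := E (fun V => rotation V k i * rotation V k j).
have e_rot (k1 l1 : 'I_4) : k1 != ord0 -> l1 = (k1 %% 3)%N.+1 :> nat -> e l1 = e k1.
  move=> k0 l1E; rewrite /e.
  pose g : SU2 R := MkSU2 rot3_subproof.
  rewrite -[RHS](haar_translate mu_haar g (bounded_measurable_rotation2 k1 i k1 j)).
  apply: eq_Rintegral => V _.
  have rk : (@rot3 R)^t* *m pauli k1 *m rot3 = 1%:C *: pauli l1.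
    by rewrite scale1r; exact: rot3_conj.
  by rewrite !(rotationM _ _ rk) !mul1r.
(* Orthonormality of the columns holds for every V, hence after integration. *)
have sum_e : \sum_k e k = (i == j)%:R.
  rewrite -haar_sum// -[RHS]haar_cst; apply: eq_Rintegral => V _.
  have /andP[uV _] := su2_mxP V.
  exact: rotation_orthogonal.
have e0 : e ord0 = ((i == ord0) && (j == ord0))%:R by exact: haar_rotation0.
move=> k0; rewrite -[LHS]/(e k); clearbody e.
have e12 := e_rot (@Ordinal 4 1 isT) (@Ordinal 4 2 isT) isT erefl.
have e23 := e_rot (@Ordinal 4 2 isT) (@Ordinal 4 3 isT) isT erefl.
(* With the three nonzero rows contributing equally, the sum is e_0 + 3 e_1, which determines
   e_1. *)
have e1 : e (@Ordinal 4 1 isT) = ((i == j) && (i != ord0))%:R / 3.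
  move: sum_e; rewrite !big_ord_recl big_ord0.
  rewrite (_ : lift ord0 (lift ord0 (lift ord0 ord0)) = @Ordinal 4 3 isT);
    last exact: val_inj.
  rewrite (_ : lift ord0 (lift ord0 ord0) = @Ordinal 4 2 isT); last exact: val_inj.
  rewrite (_ : lift ord0 ord0 = @Ordinal 4 1 isT); last exact: val_inj.
  rewrite e23 e12 e0.
  have [<-|ij] := eqVneq i j.
    by case: (i == ord0) => /=; lra.
  have [i0|i0] := eqVneq i ord0; have [j0|j0] := eqVneq j ord0 => /=; try lra.
  by rewrite i0 j0 eqxx in ij.
rewrite -e1; case: k k0 => [[|[|[|[|//]]]] hk] // _.
- by congr e; exact: val_inj.
- by rewrite -e12; congr e; exact: val_inj.
- by rewrite -e12 -e23; congr e; exact: val_inj.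
Qed.

End Haar.

(** * The asymmetry *)

Lemma tensmx1 (K : pzRingType) m n : tensmx (1%:M : 'M[K]_m) (1%:M : 'M[K]_n) = 1%:M.
Proof.
apply/matrixP => i j; rewrite !mxE -natrM mulnb -xpair_eqE -!surjective_pairing.
by rewrite (can_eq (@mxtens_unindexK m n)).
Qed.

(** * Frobenius norm of a commutator *)

Section Frobenius.
Context {R : realType}.
Local Notation C := R[i].

Lemma trace_adj_mulE n (A : 'M[C]_n) : \tr (A^t* *m A) = \sum_i \sum_j `|A j i| ^+ 2.
Proof.
by apply: eq_bigr => i _; rewrite mxE; apply: eq_bigr => j _; rewrite !mxE mulrC -normCK.
Qed.

Lemma trace_adj_mul_ge0 n (A : 'M[C]_n) : 0 <= \tr (A^t* *m A).
Proof.
by rewrite trace_adj_mulE; do 2 (apply: sumr_ge0 => ? _); rewrite exprn_ge0.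
Qed.

Lemma trace_adj_mul_eq0 n (A : 'M[C]_n) : \tr (A^t* *m A) = 0 -> A = 0.
Proof.
have sq_ge0 i j : true -> 0 <= `|A j i| ^+ 2 by rewrite exprn_ge0.
rewrite trace_adj_mulE => /psumr_eq0P A0; apply/matrixP => j i; rewrite mxE.
apply/eqP; rewrite -normr_eq0 -sqrf_eq0; apply/eqP.
apply: (psumr_eq0P (sq_ge0 i)) => //.
by apply: A0 => // k _; apply: sumr_ge0.
Qed.

Lemma frobenius_sqr n (A : 'M[C]_n) :
  (frobenius A ^+ 2) = complex.Re (\tr (A^t* *m A)).
Proof. by rewrite sqr_sqrtr//; have := trace_adj_mul_ge0 A; rewrite lecE => /andP[]. Qed.

Lemma Re_mxtraceB4 n (A1 A2 A3 A4 : 'M[C]_n) :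
  complex.Re (\tr (A1 - A2 - (A3 - A4))) =
  complex.Re (\tr A1) - complex.Re (\tr A2) -
    (complex.Re (\tr A3) - complex.Re (\tr A4)).
Proof.
by rewrite !(raddfB (@mxtrace _ n)) !(raddfB (@complex.Re R : Rcomplex R -> R)).
Qed.

(** Of the four terms of the expanded square, unitarity and cyclicity turn the two diagonal ones
    into Tr rho^2 and the two cross ones into the same twirled trace. *)
Lemma frobenius_commutator n (U rho : 'M[C]_n) :
  U \is unitarymx -> rho^t* = rho ->
  frobenius (commutator U rho) ^+ 2 =
  2 * complex.Re (\tr (rho *m rho)) -
  2 * complex.Re (\tr (rho *m (U *m rho *m U^t*))).
Proof.
move=> uU hrho; rewrite frobenius_sqr /commutator.
have -> : (U *m rho - rho *m U)^t* = (U *m rho)^t* - (rho *m U)^t*.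
  by apply/matrixP => i j; rewrite !mxE rmorphB.
rewrite (adjmxM U rho) (adjmxM rho U) hrho mulmxBl !mulmxBr [LHS]Re_mxtraceB4.
have -> : \tr (rho *m U^t* *m (U *m rho)) = \tr (rho *m rho).
  by rewrite -mulmxA (mulmxA (U^t*)) adj_unitarymxK// mul1mx.
have -> : \tr (U^t* *m rho *m (rho *m U)) = \tr (rho *m rho).
  by rewrite mxtrace_mulC -!mulmxA (mulmxA U) (unitarymxP uU) mul1mx.
have -> : \tr (rho *m U^t* *m (rho *m U)) = \tr (rho *m (U *m rho *m U^t*)).
  by rewrite mxtrace_mulC -!mulmxA mxtrace_mulC !mulmxA.
have -> : \tr (U^t* *m rho *m (U *m rho)) = \tr (rho *m (U *m rho *m U^t*)).
  by rewrite -mulmxA mxtrace_mulC !mulmxA.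
ring.
Qed.

End Frobenius.

Theorem mainTheorem3 (R : realType) (mu : probability (SU2 R) R)
    (mu_haar : is_haar mu)
    (rho : 'M[R[i]]_(2 * 2)) (rho_density : density rho)
    (T : 'I_4 -> 'I_4 -> R)
    (rhoE : rho = 4^-1 *:
       \sum_(x1 < 4) \sum_(x2 < 4)
         (T x1 x2)%:C *: tensmx (pauli x1) (pauli x2)) :
  (asymmetry mu collective rho)%:C =
  2^-1 - (8 * \tr (rho *m rho))^-1 *
    (1 + 3^-1 *
       (\sum_(i < 4 | i != ord0) \sum_(j < 4 | j != ord0) T i i * T j j)%:C).
Proof.
have [_ tr1] := rho_density.
(* Only s_0 (x) s_0 has nonzero trace, namely 4, so the trace condition fixes this coefficient. *)
have T00 : T ord0 ord0 = 1.
  apply: (@complexI R); rewrite -[RHS]tr1 rhoE mxtraceZ raddf_sum/=.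
  rewrite (bigD1 ord0)//= [X in _ * (_ + X)]big1 ?addr0; last first.
    move=> a a0; rewrite raddf_sum big1// => b _.
    by rewrite /= mxtraceZ mxtrace_tens pauli_tr (negbTE a0) mul0r mulr0.
  rewrite raddf_sum (bigD1 ord0)//= [X in _ * (_ + X)]big1 ?addr0; last first.
    by move=> b b0; rewrite mxtraceZ mxtrace_tens (pauli_tr b) (negbTE b0) !mulr0.
  by rewrite mxtraceZ mxtrace_tens !pauli_tr mulrCA -natrM mulVf ?mulr1// pnatr_eq0.
(* The coefficients are real and the products of Pauli matrices are Hermitian. *)
have rho_herm : rho^t* = rho.
  rewrite rhoE linearZ /= map_mxZ; congr (_ *: _); first by rewrite fmorphV rmorph_nat.
  rewrite raddf_sum map_mx_sum; apply: eq_bigr => a _.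
  rewrite raddf_sum map_mx_sum; apply: eq_bigr => b _.
  rewrite /= linearZ map_mxZ /= adjmx_tens !pauli_adj; congr (_ *: _).
  exact: conjc_real.
set P := complex.Re (\tr (rho *m rho)).
have PE : \tr (rho *m rho) = P%:C by exact: mxtrace_herm_real.
(* Vanishing purity would force rho = 0, against trace 1; this justifies dividing by P at the
   end. *)
have P0 : P != 0.
  apply/eqP => P0; have /trace_adj_mul_eq0 rho0 : \tr (rho^t* *m rho) = 0.
    by rewrite rho_herm PE P0.
  by move: tr1; rewrite rho0 mxtrace0 => /esym/eqP; rewrite oner_eq0.
(* The coefficient -1/2 is the -2 of the commutator formula times the 1/4 of [trace_twirl]. *)
have frobE (V : SU2 R) : frobenius (commutator (collective V) rho) ^+ 2 =
   2 * P + - 2^-1 * \sum_(a < 4) \sum_(b < 4) \sum_(i < 4) \sum_(j < 4)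
    T a b * T i j * (rotation V a i * rotation V b j).
  have /andP[uV _] := su2_mxP V.
  rewrite frobenius_commutator//; last first.
    by apply/unitarymxP; rewrite adjmx_tens tensmx_mul (unitarymxP uV) tensmx1.
  rewrite (trace_twirl V rhoE) /= -/P; lra.
set S := \sum_(i < 4 | _) _.
have mrot k i l j :
    bounded_measurable (fun V : SU2 R => rotation V k i * rotation V l j).
  by apply: bounded_measurableM; exact: bounded_measurable_rotation.
have mTrot a b i j : bounded_measurable (fun V : SU2 R =>
    T a b * T i j * (rotation V a i * rotation V b j)).
  by apply: bounded_measurableM => //; exact: bounded_measurable_cst.
have intE : \int[mu]_(V in [set: SU2 R])
    (\sum_(a < 4) \sum_(b < 4) \sum_(i < 4) \sum_(j < 4)
    T a b * T i j * (rotation V a i * rotation V b j)) = 1 + 3^-1 * S.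
  (* The moments with a != b vanish, which leaves the diagonal coefficients [T a a]. *)
  transitivity (\sum_(a < 4) \sum_(i < 4) \sum_(j < 4) T a a * T i j *
     \int[mu]_(V in [set: SU2 R]) (rotation V a i * rotation V a j)).
    rewrite haar_sum; last first.
      by move=> a; do 3 (apply: bounded_measurable_sum => ? _).
    apply: eq_bigr => a _; rewrite haar_sum; last first.
      by move=> b; do 2 (apply: bounded_measurable_sum => ? _).
    rewrite (bigD1 a)//= [X in _ + X]big1 ?addr0 => [|b ba].
      rewrite haar_sum => [|i]; last by apply: bounded_measurable_sum => ? _.
      apply: eq_bigr => i _; rewrite haar_sum//; apply: eq_bigr => j _.
      by rewrite haarZ.
    rewrite haar_sum => [|i]; last by apply: bounded_measurable_sum => ? _.
    rewrite big1// => i _; rewrite haar_sum// big1// => j _.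
    by rewrite haarZ// haar_rotation_neq ?mulr0// eq_sym.
  (* The row a = 0 contributes only at i = j = 0, where T_00^2 = 1; the nonzero rows must then give
     S / 3. *)
  rewrite (bigD1 ord0)//=; congr (_ + _).
    rewrite (bigD1 ord0)//= [X in _ + X]big1 ?addr0 => [|i i0].
      rewrite (bigD1 ord0)//= [X in _ + X]big1 ?addr0 => [|j j0].
        by rewrite haar_rotation0 T00 !mulr1.
      by rewrite haar_rotation0 (negbTE j0) mulr0.
    by rewrite big1// => j _; rewrite haar_rotation0 (negbTE i0) mulr0.
  (* For a nonzero row only i = j != 0 survives, with moment 1/3. *)
  rewrite mulr_sumr; apply: eq_bigr => a a0; rewrite mulr_sumr.
  rewrite [LHS](bigD1 ord0 isT) /= [X in X + _]big1 => [|j _]; last first.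
    by rewrite haar_rotation_eq // eqxx andbF mul0r mulr0.
  rewrite add0r; apply: eq_bigr => i i0.
  rewrite [LHS](bigD1 i isT) /= [X in _ + X]big1 => [|j ji]; last first.
    by rewrite haar_rotation_eq // [i == j]eq_sym (negbTE ji) mul0r mulr0.
  by rewrite addr0 haar_rotation_eq // eqxx i0 mulrC mul1r.
(* The integral is 2P - (1 + S/3)/2, and the prefactor is 1/(4P). *)
have -> : asymmetry mu collective rho = 2^-1 - (8 * P)^-1 * (1 + 3^-1 * S).
  rewrite /asymmetry frobenius_sqr rho_herm -/P.
  under eq_Rintegral do rewrite frobE.
  have msum : bounded_measurable (fun V : SU2 R =>
    \sum_(a < 4) \sum_(b < 4) \sum_(i < 4) \sum_(j < 4)
    T a b * T i j * (rotation V a i * rotation V b j)).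
    by do 4 (apply: bounded_measurable_sum => ? _).
  rewrite haarD; [|exact: bounded_measurable_cst|
    by apply: bounded_measurableM => //; exact: bounded_measurable_cst].
  by rewrite haar_cst haarZ// intE; field.
by rewrite PE !(rmorphB, rmorphM, rmorphD, fmorphV, rmorph_nat, rmorph1).
Qed.
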